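(* There is an absolute constant $C>0$ such that the following holds. Let $X,Y$ be finite sets with $|Y|\ge2$, let $\gamma>0$, and let $A\in\mathbb{R}^{X\times Y}$ be an $\varepsilon$-almost integer-valued matrix with $\|A\|_{\gamma_2}\le\gamma$, where $\varepsilon=2^{-20\gamma^2}$. Then $$\operatorname{block}(A_{\mathbb Z})\le 2^{C\gamma^7}(\log|Y|)^2 .$$
   Context: For $A\in\mathbb{R}^{X\times Y}$, $A_{\mathbb Z}\in\mathbb{Z}^{X\times Y}$ denotes the entrywise rounding of $A$ to the nearest integer, where $b+1/2$ is rounded down to $b$ for every $b\in\mathbb Z$. For $\varepsilon>0$, $A$ is $\varepsilon$-almost integer-valued if $\max_{x,y}|A(x,y)-A_{\mathbb Z}(x,y)|\le\varepsilon$. The $\gamma_2$ factorization norm is $\|A\|_{\gamma_2}=\min_{UV=A}\|U\|_{\mathrm{row}}\|V\|_{\mathrm{col}}$, over all factorizations $A=UV$, where $\|U\|_{\mathrm{row}}$ is the largest Euclidean norm of a row of $U$ and $\|V\|_{\mathrm{col}}$ the largest Euclidean norm of a column of $V$. A boolean matrix is blocky if its support equals $\bigcup_iS_i\times T_i$ for pairwise disjoint row sets $S_i$ and pairwise disjoint column sets $T_i$; the block complexity $\operatorname{block}(B)$ of an integer matrix $B$ is the least $L\ge0$ with $B=\sum_{i=1}^L\sigma_iB_i$ for blocky $B_i$ and signs $\sigma_i\in\{-1,1\}$. $\log$ is the natural logarithm. *)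

(* Defs.v *)
From HB Require Import structures.
From mathcomp Require Import all_boot all_order all_algebra.
From mathcomp Require Import all_classical all_reals all_analysis.
From mathcomp Require Import Rstruct Rstruct_topology.
From Stdlib Require Import Rdefinitions.

Set Implicit Arguments.
Unset Strict Implicit.
Unset Printing Implicit Defensive.

Import Order.TTheory GRing.Theory Num.Theory.
Local Open Scope ring_scope.


Definition rmat (X Y : finType) := X -> Y -> R.
Definition imat (X Y : finType) := X -> Y -> int.

(* Rounding to the nearest integer, with b + 1/2 rounded down to b. *)
Definition round_near (a : R) : int := Num.ceil (a - 2^-1).

Definition roundZ (X Y : finType) (A : rmat X Y) : imat X Y :=
  fun x y => round_near (A x y).

Definition almost_int (X Y : finType) (eps : R) (A : rmat X Y) : Prop :=
  forall x y, `|A x y - (roundZ A x y)%:~R| <= eps.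

Definition row_norm (X : finType) (k : nat) (U : X -> 'I_k -> R) : R :=
  \big[Order.max/0]_(x : X) Num.sqrt (\sum_(i < k) U x i ^+ 2).
Definition col_norm (Y : finType) (k : nat) (V : 'I_k -> Y -> R) : R :=
  \big[Order.max/0]_(y : Y) Num.sqrt (\sum_(i < k) V i y ^+ 2).

(* gamma_2 norm: min over all factorizations A = U V (any inner dimension k)
   of ||U||_row * ||V||_col; stated as the infimum (the min is attained). *)
Definition gamma2 (X Y : finType) (A : rmat X Y) : R :=
  inf [set r : R | exists (k : nat) (U : X -> 'I_k -> R) (V : 'I_k -> Y -> R),
        (forall x y, A x y = \sum_(i < k) U x i * V i y) /\
        r = row_norm U * col_norm V]%classic.

Definition blocky (X Y : finType) (B : imat X Y) : Prop :=
  (forall x y, B x y = 0 \/ B x y = 1) /\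
  exists (n : nat) (S : 'I_n -> {set X}) (T : 'I_n -> {set Y}),
    (forall i j, i != j -> [disjoint S i & S j]) /\
    (forall i j, i != j -> [disjoint T i & T j]) /\
    (forall x y, B x y != 0 <-> exists i, x \in S i /\ y \in T i).

Definition block_decomp (X Y : finType) (B : imat X Y) (L : nat) : Prop :=
  exists (Bs : 'I_L -> imat X Y) (sg : 'I_L -> int),
    (forall i, blocky (Bs i)) /\
    (forall i, sg i = 1 \/ sg i = -1) /\
    (forall x y, B x y = \sum_(i < L) sg i * Bs i x y).

Definition block (X Y : finType) (B : imat X Y) : R :=
  inf [set r : R | exists L : nat, block_decomp B L /\ r = L%:R]%classic.

(* Main.v *)
(* Write A(x,y) = <u_x, v_y> with |u_x| <= 1 and |v_y|^2 <= G = O(gamma^2), and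
   let B be the integer matrix close to A.  Inside a set of columns on which a
   row of B does not vanish, choose T maximizing |m_T|^2 + lambda ln |T|, where
   m_T is the mean of the v_y over T.  Maximality makes T large, forces every
   row of B to be constant on all but an exponentially small part of T (a
   balanced split of T would gain more energy than the entropy it costs), and
   makes |v_y - m_T|^2 <= |v_y|^2 - 1/2 for every y in T.  Replacing v_y by
   v_y - m_T amounts to subtracting from B a matrix that is constant in each row
   along T.

   Clusters are taken greedily from the heaviest rows; between two halvings of
   the maximal row degree, each row meets boundedly many of them, so the matrix
   subtracted is row-sparse up to duplication of columns.  Row-sparse matrices
   are decomposed using O(log |Y|) random colourings of the columns, each row
   being assigned a colouring that is injective on its support.  This gives
   O(log |Y|) stages costing O(log |Y|) blocky matrices each, and after 2G rounds
   the column norms are too small for B to be nonzero. *)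
Require Import Defs.
From HB Require Import structures.
From mathcomp Require Import all_boot all_order all_algebra.
From mathcomp Require Import reals sequences exp.
From mathcomp Require Import ring lra zify.

Set Implicit Arguments.
Unset Strict Implicit.
Unset Printing Implicit Defensive.

Import Order.TTheory GRing.Theory Num.Theory.
Local Open Scope ring_scope.

(** * Clusters of vectors *)

Definition dot (R : realType) (k : nat) (u v : 'rV[R]_k) : R :=
  \sum_i u 0 i * v 0 i.

Lemma dotC (R : realType) k (u v : 'rV[R]_k) : dot u v = dot v u.
Proof. by apply: eq_bigr => i _; rewrite mulrC. Qed.

Lemma dotDr (R : realType) k (u v w : 'rV[R]_k) :
  dot u (v + w) = dot u v + dot u w.
Proof. by rewrite -big_split /=; apply: eq_bigr => i _; rewrite mxE mulrDr. Qed.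

Lemma dotZr (R : realType) k a (u v : 'rV[R]_k) : dot u (a *: v) = a * dot u v.
Proof. by rewrite mulr_sumr; apply: eq_bigr => i _; rewrite mxE mulrCA. Qed.

Lemma dotNr (R : realType) k (u v : 'rV[R]_k) : dot u (- v) = - dot u v.
Proof. by rewrite -scaleN1r dotZr mulN1r. Qed.

Lemma dot0r (R : realType) k (u : 'rV[R]_k) : dot u 0 = 0.
Proof. by rewrite -(scale0r 0) dotZr mul0r. Qed.

Lemma dotDl (R : realType) k (u v w : 'rV[R]_k) :
  dot (u + v) w = dot u w + dot v w.
Proof. by rewrite dotC dotDr !(dotC w). Qed.

Lemma dotZl (R : realType) k a (u v : 'rV[R]_k) : dot (a *: u) v = a * dot u v.
Proof. by rewrite dotC dotZr dotC. Qed.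

Lemma dotNl (R : realType) k (u v : 'rV[R]_k) : dot (- u) v = - dot u v.
Proof. by rewrite dotC dotNr dotC. Qed.

Definition dotE := (dotDr, dotDl, dotNr, dotNl, dotZr, dotZl).

Lemma dotBB (R : realType) k (a b : 'rV[R]_k) :
  dot (a - b) (a - b) = dot a a - 2 * dot a b + dot b b.
Proof. rewrite !dotE (dotC b a); ring. Qed.

Lemma dot_sumr (R : realType) k (I : finType) (A : {set I}) (u : 'rV[R]_k)
  (v : I -> 'rV[R]_k) : dot u (\sum_(i in A) v i) = \sum_(i in A) dot u (v i).
Proof.
by elim/big_rec2: _ => [|i x y _ <-]; rewrite ?dot0r ?dotDr.
Qed.

Lemma dot_ge0 (R : realType) k (u : 'rV[R]_k) : 0 <= dot u u.
Proof. by apply: sumr_ge0 => i _; rewrite -expr2 sqr_ge0. Qed.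

(** Cauchy-Schwarz in the form used throughout: expand the squared length of [w - dot u w *: u] and
    bound [dot u u] by 1. *)
Lemma dot_sqr_le (R : realType) k (u w : 'rV[R]_k) :
  dot u u <= 1 -> dot u w ^+ 2 <= dot w w.
Proof.
move=> u1; have := dot_ge0 (w - dot u w *: u).
rewrite !dotE (dotC w u); set d := dot u w.
have : 0 <= d ^+ 2 * (1 - dot u u) by rewrite mulr_ge0 ?sqr_ge0 ?subr_ge0.
lra.
Qed.

Definition mean (R : realType) (k : nat) (Y : finType) (v : Y -> 'rV[R]_k)
  (T : {set Y}) : 'rV[R]_k := #|T|%:R^-1 *: \sum_(y in T) v y.

Lemma cardR_gt0 (R : realType) (Y : finType) (T : {set Y}) :
  T != set0 -> 0 < #|T|%:R :> R.
Proof. by rewrite ltr0n card_gt0. Qed.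

Lemma mean_le (R : realType) k (Y : finType) (v : Y -> 'rV[R]_k)
  (T : {set Y}) u a : T != set0 ->
  (forall y, y \in T -> dot u (v y) <= a) -> dot u (mean v T) <= a.
Proof.
move=> /(cardR_gt0 R) T0 H; rewrite dotZr dot_sumr mulrC ler_pdivrMr // mulr_natr -sumr_const.
exact: ler_sum.
Qed.

Lemma mean_ge (R : realType) k (Y : finType) (v : Y -> 'rV[R]_k)
  (T : {set Y}) u a : T != set0 ->
  (forall y, y \in T -> a <= dot u (v y)) -> a <= dot u (mean v T).
Proof.
move=> T0 H; rewrite -lerN2 -dotNl; apply: mean_le => // y yT.
by rewrite dotNl lerN2 H.
Qed.

(** Averaging [2 * dot m (v y) <= dot m m + dot (v y) (v y)] over [T] turns the left side into
    [2 * dot m m]. *)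
Lemma dot_mean_mean_le (R : realType) k (Y : finType) (v : Y -> 'rV[R]_k)
  (T : {set Y}) G : T != set0 ->
  (forall y, y \in T -> dot (v y) (v y) <= G) ->
  dot (mean v T) (mean v T) <= G.
Proof.
move=> T0 H; set m := mean v T.
suff : dot m m <= (dot m m + G) / 2 by lra.
apply: mean_le => // y yT; have := dot_ge0 (m - v y).
rewrite dotBB; have := H y yT; lra.
Qed.

Lemma mean_split (R : realType) k (Y : finType) (v : Y -> 'rV[R]_k)
  (T T2 : {set Y}) : T2 \subset T -> T2 != set0 -> T :\: T2 != set0 ->
  #|T|%:R *: mean v T =
    #|T :\: T2|%:R *: mean v (T :\: T2) + #|T2|%:R *: mean v T2.
Proof.
move=> sT T20 T10; have T0 : T != set0.
  by apply: contraNneq T20 => T0; rewrite -subset0 -T0.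
rewrite !scalerA !mulfV ?gt_eqF ?cardR_gt0 // !scale1r.
by rewrite (big_setID T2) /= (setIidPr sT) addrC.
Qed.

(** Only subsets of [T] compete, so the property does not refer to the set in which [T] was
    found. *)
Definition cluster (R : realType) (k : nat) (Y : finType) (v : Y -> 'rV[R]_k)
    (lam : R) (T : {set Y}) : Prop :=
  T != set0 /\ forall S : {set Y}, S \subset T -> S != set0 ->
    dot (mean v S) (mean v S) + lam * ln #|S|%:R <=
    dot (mean v T) (mean v T) + lam * ln #|T|%:R.

(** The maximizer is compared with [Y0] itself: energies lie between 0 and [G], so the logarithm of
    the size drops by at most [G / lam]. *)
Lemma cluster_exists (R : realType) k (Y : finType) (v : Y -> 'rV[R]_k)
  (lam G : R) (Y0 : {set Y}) : 0 < lam -> Y0 != set0 ->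
  (forall y, dot (v y) (v y) <= G) ->
  exists T : {set Y}, [/\ T \subset Y0, cluster v lam T &
    #|Y0|%:R * expR (- (G / lam)) <= #|T|%:R].
Proof.
move=> lam0 Y00 vG.
pose P (S : {set Y}) := (S \subset Y0) && (S != set0).
pose F (S : {set Y}) := dot (mean v S) (mean v S) + lam * ln #|S|%:R.
have PY0 : P Y0 by rewrite /P subxx.
case: (Order.TotalTheory.arg_maxP F PY0) => T /andP[TY0 T0] Tmax.
exists T; split => //.
  by split => // S ST S0; apply: Tmax; rewrite /P S0 (subset_trans ST).
have := Tmax _ PY0; rewrite /F /= => h.
have h1 := dot_mean_mean_le T0 (fun y _ => vG y).
have h2 := dot_ge0 (mean v Y0).
have h3 : lam * ln #|Y0|%:R <= G + lam * ln #|T|%:R by lra.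
rewrite -[leRHS]lnK ?posrE ?cardR_gt0 // -[X in X * _]lnK ?posrE ?cardR_gt0 //.
rewrite -expRD ler_expR -(ler_pM2l lam0) mulrDr mulrN [lam * (G / _)]mulrC divfK ?gt_eqF //.
lra.
Qed.

Lemma ln_le_sub1 (R : realType) (x : R) : 0 < x -> ln x <= x - 1.
Proof.
by move=> x0; have := @le_ln1Dx R (x - 1); rewrite [1 + _]addrC subrK; apply; lra.
Qed.

(* Deleting [y] from an optimal set cannot increase the potential. *)
Lemma cluster_dot (R : realType) k (Y : finType) (v : Y -> 'rV[R]_k) (lam : R)
  (T : {set Y}) y : 0 < lam -> cluster v lam T -> y \in T ->
  dot (v y - mean v T) (v y - mean v T) <=
  dot (v y) (v y) - dot (mean v T) (mean v T) + lam.
Proof.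
move=> lam0 [T0 opt] yT.
set m := mean v T.
(* The squared distance equals [|v y|^2 - |m|^2 + 2 (|m|^2 - <m, v y>)]. *)
suff : dot m m - dot m (v y) <= lam / 2.
  rewrite dotBB (dotC _ m); lra.
have yT' : [set y] \subset T by rewrite sub1set.
have y0 : [set y] != set0 by rewrite -card_gt0 cards1.
have [T10|T10] := eqVneq (T :\: [set y]) set0.
  have TE : T = [set y].
    by apply/eqP; rewrite eqEsubset yT' andbT -setD_eq0 T10.
  rewrite /m TE /mean big_set1 cards1 invr1 scale1r; lra.
have := opt _ (subsetDl T [set y]) T10.
have := mean_split v yT' y0 T10.
have cT : #|T|%:R = #|T :\: [set y]|%:R + 1 :> R.
  by rewrite (cardsD1 y T) yT addrC -natr1 addrC.
have vy : mean v [set y] = v y by rewrite /mean big_set1 cards1 invr1 scale1r.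
rewrite cT vy cards1 scale1r -/m.
have := cardR_gt0 R T10; set m1 := mean v _; set t := _%:R => t0 mE h.
clearbody m m1.
have lnh : ln (t + 1) - ln t <= t^-1.
  rewrite -ln_div ?posrE ?(addr_gt0 t0) //; apply: le_trans (ln_le_sub1 _) _.
    by rewrite divr_gt0 // addr_gt0.
  by rewrite mulrDl divff ?gt_eqF // mul1r addrC addKr.
(* With [t = #|T| - 1], deleting [y] gains at least [2 (|m|^2 - <m, v y>) / t] in energy and costs
   at most [1 / t] in the logarithm. *)
have m1E : m1 = m + t^-1 *: (m - v y).
  apply: (scalerI (lt0r_neq0 t0)).
  rewrite scalerDr scalerA divff ?gt_eqF // scale1r.
  by rewrite addrA -{2}[m]scale1r -scalerDl mE addrK.
have h1 : dot m1 m1 <= dot m m + lam * t^-1.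
  have := ler_wpM2l (ltW lam0) lnh; rewrite mulrBr; lra.
have h2 : dot m m + t^-1 * (2 * (dot m m - dot m (v y))) <= dot m1 m1.
  have := dot_ge0 (t^-1 *: (m - v y)); rewrite m1E !dotE (dotC (v y) m).
  lra.
have : t^-1 * (2 * (dot m m - dot m (v y))) <= t^-1 * lam by lra.
rewrite ler_pM2l ?invr_gt0 //; lra.
Qed.

(* The energy gained by splitting an optimal set is at most the entropy lost. *)
Lemma cluster_split (R : realType) k (Y : finType) (v : Y -> 'rV[R]_k) (lam : R)
  (T S : {set Y}) u : 0 < lam -> cluster v lam T -> S \subset T ->
  S != set0 -> (#|S|.*2 <= #|T|)%N -> dot u u <= 1 ->
  9 / 16 <= (dot u (mean v (T :\: S)) - dot u (mean v S)) ^+ 2 ->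
  #|S|%:R <= #|T|%:R * expR (1 - 1 / (4 * lam)) :> R.
Proof.
move=> lam0 [T0 opt] sST S0 half u1 gap.
have cTS : (#|T :\: S| + #|S| = #|T|)%N.
  by rewrite cardsD (setIidPr sST) subnK ?subset_leq_card.
have T10 : T :\: S != set0.
  rewrite -card_gt0; move: S0 half; rewrite -card_gt0 -addnn -cTS leq_add2r.
  exact: leq_trans.
have o1 := opt _ (subsetDl T S) T10; have o2 := opt _ sST S0.
have mE := mean_split v sST S0 T10.
have s1 := cardR_gt0 R T10; have s2 := cardR_gt0 R S0.
have hs : #|S|%:R <= #|T :\: S|%:R :> R.
  by rewrite ler_nat -(leq_add2r #|S|) addnn cTS.
move: o1 o2 mE s1 s2 hs gap.
have -> : #|T|%:R = #|T :\: S|%:R + #|S|%:R :> R by rewrite -natrD cTS.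
set m := mean v T; set m1 := mean v _; set m2 := mean v S.
clearbody m m1 m2.
set a := #|T :\: S|%:R; set b := #|S|%:R => o1 o2 mE a0 b0 ba gap.
have ab0 : 0 < a + b by rewrite addr_gt0.
have gap' : 9 / 16 <= dot (m1 - m2) (m1 - m2).
  by apply: le_trans gap _; rewrite -dotNr -dotDr; exact: dot_sqr_le.
(* Variance identity: the weighted energies of the parts exceed that of the whole by the variance
   between the parts. *)
have var : (a + b) * (a * dot m1 m1 + b * dot m2 m2) =
    (a + b) ^+ 2 * dot m m + a * b * dot (m1 - m2) (m1 - m2).
  have : dot ((a + b) *: m) ((a + b) *: m) = dot (a *: m1 + b *: m2) (a *: m1 + b *: m2).
    by rewrite mE.
  rewrite !dotE (dotC m2 m1) => h.
  have -> : (a + b) ^+ 2 * dot m m = (a + b) * ((a + b) * dot m m) by ring.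
  rewrite h; ring.
have l1 : ln (a + b) - ln a <= b / a.
  rewrite -ln_div ?posrE //; apply: le_trans (ln_le_sub1 _) _; first by rewrite divr_gt0.
  by rewrite mulrDl divff ?gt_eqF // addrC addKr.
set l := ln (a + b) - ln b.
(* Optimality against each part, weighted by its size; the sum is then compared with [var]. *)
have e1 : a * dot m1 m1 <= a * dot m m + lam * b.
  have : a * (dot m1 m1 - dot m m) <= a * (lam * (b / a)).
    rewrite ler_pM2l //; have := ler_wpM2l (ltW lam0) l1; rewrite mulrBr; lra.
  by rewrite (_ : a * (lam * (b / a)) = lam * b); [lra | field; rewrite gt_eqF].
have e2 : b * dot m2 m2 <= b * dot m m + lam * b * l.
  have : b * (dot m2 m2 - dot m m) <= b * (lam * l).
    rewrite ler_pM2l // /l mulrBr; lra.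
  lra.
have e3 : a * b * dot (m1 - m2) (m1 - m2) <= (a + b) * (lam * b * (1 + l)).
  have := ler_wpM2l (ltW ab0) (lerD e1 e2); rewrite var; lra.
have e4 : 9 / 16 * a <= (a + b) * (lam * (1 + l)).
  have : b * (9 / 16 * a) <= b * ((a + b) * (lam * (1 + l))).
    have := ler_wpM2l (ltW (mulr_gt0 a0 b0)) gap'; lra.
  by rewrite ler_pM2l.
(* Since [b <= a], the left side of [e4] is at least 9/32 of [a + b]. *)
have e5 : 1 / 4 <= lam * (1 + l).
  have : (a + b) * (1 / 4) <= (a + b) * (lam * (1 + l)) by lra.
  by rewrite ler_pM2l.
have e6 : 1 / (4 * lam) <= 1 + l.
  rewrite ler_pdivrMr ?mulr_gt0 //; lra.
rewrite -[leLHS]lnK ?posrE // -[X in X * _]lnK ?posrE // -expRD ler_expR.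
by move: e6; rewrite /l; lra.
Qed.

(** The value [b z] is a median of [b] on [T]. The points strictly above it, and those strictly
    below, fill at most half of [T] each; by integrality either set is separated in mean from its
    complement by at least [1 - 2 e >= 3/4], so [cluster_split] makes both small. *)
Lemma cluster_majority (R : realType) k (Y : finType) (v : Y -> 'rV[R]_k)
  (lam e : R) (T : {set Y}) u (b : Y -> int) :
  0 < lam -> cluster v lam T -> dot u u <= 1 -> e <= 1 / 8 ->
  (forall y, `|dot u (v y) - (b y)%:~R| <= e) ->
  exists2 z, z \in T & #|[set y in T | b y != b z]|%:R <=
    #|T|%:R * (2 * expR (1 - 1 / (4 * lam))) :> R.
Proof.
move=> lam0 clT u1 e8 near; have [T0 _] := clT.
have [y0 y0T] := set0Pn _ T0.
case: (Order.TotalTheory.arg_minP b y0T) => y1 y1T y1min.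
(* An upper median: the largest value that at least half of [T] reaches. The minimum of [b] on [T]
   is always such a value. *)
pose P z := (z \in T) && (#|T| <= #|[set y in T | (b z <= b y)%R]|.*2)%N.
have Py1 : P y1.
  apply/andP; split; first exact: y1T.
  have -> : [set y in T | b y1 <= b y] = T.
    by apply/setP => y; rewrite inE; case: (boolP (y \in T)) => //= yT; exact: y1min.
  by rewrite -addnn leq_addr.
case: (Order.TotalTheory.arg_maxP b Py1) => z /andP[zT zhalf] zmax.
have {}zT : z \in T by exact: zT.
exists z => //.
have bound (S : {set Y}) : S \subset T -> (#|S|.*2 <= #|T|)%N ->
    (S != set0 -> T :\: S != set0 ->
      9 / 16 <= (dot u (mean v (T :\: S)) - dot u (mean v S)) ^+ 2) ->
    #|S|%:R <= #|T|%:R * expR (1 - 1 / (4 * lam)) :> R.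
  move=> sST half gap; have [->|S0] := eqVneq S set0.
    by rewrite cards0 mulr_ge0 // expR_ge0.
  apply: (cluster_split lam0 clT sST S0 half u1); apply: gap => //.
  rewrite -card_gt0 cardsD (setIidPr sST) subn_gt0; apply: leq_trans half.
  by rewrite -addnn -[X in (X < _)%N]addn0 ltn_add2l card_gt0.
have nearD y : dot u (v y) <= (b y)%:~R + e /\ (b y)%:~R - e <= dot u (v y).
  by have := near y; rewrite ler_norml => /andP[]; lra.
have gapE (p q t : R) : t + 1 - e <= p -> q <= t + e -> 9 / 16 <= (p - q) ^+ 2.
  move=> hp hq; have : 3 / 4 <= p - q by lra.
  set d := p - q; nra.
pose U := [set y in T | b z < b y]; pose L := [set y in T | b y < b z].
have -> : [set y in T | b y != b z] = U :|: L.
  by apply/setP => y; rewrite !inE neq_lt -andb_orr orbC.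
have hU : #|U|%:R <= #|T|%:R * expR (1 - 1 / (4 * lam)) :> R.
  apply: bound.
  - by apply/fintype.subsetP => y; rewrite inE => /andP[].
  (* If more than half of [T] lay above [b z], the least value taken there would contradict the
     maximality of [b z]. *)
  - rewrite leqNgt; apply/negP => big.
    have /set0Pn[w wU] : U != set0.
      by rewrite -card_gt0 -double_gt0; apply: leq_trans big.
    case: (Order.TotalTheory.arg_minP b wU) => w' w'U w'min.
    have : w' \in U by exact: w'U.
    rewrite inE => /andP[w'T zw'].
    suff Pw' : P w' by have := zmax _ Pw'; rewrite /= leNgt zw'.
    rewrite /P w'T (leq_trans (ltnW big)) // leq_double subset_leq_card //.
    apply/fintype.subsetP => y yU; move: (yU); rewrite !inE => /andP[-> _] /=.
    exact: w'min.
  - move=> U0 TU0; rewrite -sqrrN opprB; apply: (gapE _ _ (b z)%:~R).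
      apply: mean_ge => // y; rewrite inE => /andP[_ zy].
      have [_] := nearD y; apply: le_trans; rewrite lerD2r.
      by rewrite -(intrD _ _ 1) ler_int lezD1.
    apply: mean_le => // y; rewrite !inE => /andP[+ yT]; rewrite yT /= -leNgt => yz.
    have [+ _] := nearD y; move/le_trans; apply; by rewrite lerD2r ler_int.
have hL : #|L|%:R <= #|T|%:R * expR (1 - 1 / (4 * lam)) :> R.
  have LE : L = T :\: [set y in T | b z <= b y].
    by apply/setP => y; rewrite !inE ltNge; case: (y \in T); rewrite ?andbF ?andbT.
  apply: bound.
  - by apply/fintype.subsetP => y; rewrite inE => /andP[].
  - rewrite LE cardsD (setIidPr _); last by apply/fintype.subsetP => y; rewrite inE => /andP[].
    rewrite doubleB leq_subLR; apply: leq_trans (leq_add zhalf (leqnn _)).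
    by rewrite addnn.
  - move=> L0 TL0; apply: (gapE _ _ ((b z)%:~R - 1)).
      apply: mean_ge => // y; rewrite !inE => /andP[+ yT]; rewrite yT /= -leNgt => zy.
      have [_] := nearD y; apply: le_trans; rewrite subrK lerD2r.
      by rewrite ler_int.
    apply: mean_le => // y; rewrite inE => /andP[_ yz].
    have [+ _] := nearD y; move/le_trans; apply; rewrite lerD2r lerBrDr.
    by rewrite -(intrD _ _ 1) ler_int lezD1.
apply: le_trans (_ : #|U|%:R + #|L|%:R <= _); last by lra.
by rewrite -natrD ler_nat cardsU leq_subr.
Qed.

(** * Block complexity of row-sparse matrices *)

Lemma block_decomp_ext (X Y : finType) (B B' : imat X Y) L :
  B =2 B' -> block_decomp B L -> block_decomp B' L.
Proof.
move=> BB [Bs [sg [b [s e]]]]; exists Bs, sg; do 2!split=> //.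
by move=> x y; rewrite -BB e.
Qed.

Lemma block_decomp0 (X Y : finType) :
  block_decomp (fun (_ : X) (_ : Y) => 0) 0.
Proof.
exists (fun _ _ _ => 0), (fun=> 1); split; first by case.
by split=> [|x y]; [left | rewrite big_ord0].
Qed.

Lemma block_decomp_signed (X Y : finType) (B : imat X Y) (s : int) :
  blocky B -> s = 1 \/ s = -1 -> block_decomp (fun x y => s * B x y) 1.
Proof.
move=> bB hs; exists (fun=> B), (fun=> s); do 2!split=> //.
by move=> x y; rewrite big_ord1.
Qed.

Lemma block_decompD (X Y : finType) (B1 B2 : imat X Y) L1 L2 :
  block_decomp B1 L1 -> block_decomp B2 L2 ->
  block_decomp (fun x y => B1 x y + B2 x y) (L1 + L2).
Proof.
move=> [Bs [sg [b [s e]]]] [Bs' [sg' [b' [s' e']]]].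
exists (fun i => match fintype.split i with inl j => Bs j | inr j => Bs' j end).
exists (fun i => match fintype.split i with inl j => sg j | inr j => sg' j end).
split; first by move=> i; case: fintype.split.
split; first by move=> i; case: fintype.split.
move=> x y; rewrite big_split_ord e e' /=; congr (_ + _); apply: eq_bigr => i _.
  by case: (fintype.splitP (lshift L2 i)) => j /= ij; [rewrite (ord_inj ij) | move: (ltn_ord i); rewrite ij; lia].
by case: (fintype.splitP (rshift L1 i)) => j /= ij; [move: (ltn_ord j); rewrite -ij; lia | rewrite (_ : i = j) //; apply/ord_inj; lia].
Qed.

Lemma block_decomp_sum (X Y I : finType) (B : I -> imat X Y) L :
  (forall i, block_decomp (B i) L) ->
  block_decomp (fun x y => \sum_i B i x y) (#|I| * L).
Proof.
move=> dB; rewrite cardT.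
suff h (s : seq I) : block_decomp (fun x y => \sum_(i <- s) B i x y) (size s * L).
  by apply: block_decomp_ext (h (enum I)) => x y; rewrite big_enum.
elim: s => [|i s IH].
  rewrite mul0n; by apply: block_decomp_ext (block_decomp0 X Y) => x y; rewrite big_nil.
by apply: block_decomp_ext (block_decompD (dB i) IH) => x y; rewrite big_cons.
Qed.

(** Duplicating columns along [l] and clearing those outside [p] replaces each [T i] by a preimage,
    which keeps disjointness. This is why copies of a column cost nothing. *)
Lemma blocky_comp (X Y Z : finType) (B : imat X Z) (p : pred Y) (l : Y -> Z) :
  blocky B -> blocky (fun x y => if p y then B x (l y) else 0).
Proof.
move=> [b01 [n [S [T [dS [dT supp]]]]]]; split.
  by move=> x y; case: ifP => _; [exact: b01 | left].
exists n, S, (fun i => [set y | p y && (l y \in T i)]); split=> //; split.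
  move=> i j ij; apply/pred0P => y /=; rewrite !inE; apply/negbTE/negP.
  move=> /andP[/andP[_ yi] /andP[_ yj]].
  by have /pred0P/(_ (l y)) := dT _ _ ij; rewrite /= yi yj.
move=> x y; case: ifP => py; split.
- by move=> /supp[i [xi yi]]; exists i; rewrite inE py.
- by move=> [i [xi]]; rewrite inE => /andP[_ yi]; apply/supp; exists i.
- by rewrite eqxx.
- by move=> [i [xi]]; rewrite inE py.
Qed.

Lemma block_decomp_comp (X Y Z : finType) (B : imat X Z) (p : pred Y) (l : Y -> Z) L :
  block_decomp B L ->
  block_decomp (fun x y => if p y then B x (l y) else 0) L.
Proof.
move=> [Bs [sg [b [s e]]]].
exists (fun i x y => if p y then Bs i x (l y) else 0), sg.
split; first by move=> i; exact: blocky_comp.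
split=> // x y; case: ifP => _; first exact: e.
by rewrite big1 // => i _; rewrite mulr0.
Qed.

(** Each column is its own block, with the rows supported there; uniqueness makes these row sets
    disjoint. *)
Lemma blocky_row_unique (X Y : finType) (P : X -> Y -> bool) :
  (forall x y z, P x y -> P x z -> y = z) ->
  blocky (fun x y => if P x y then 1 else 0).
Proof.
move=> uP; split; first by move=> x y; case: (P x y); [right | left].
exists #|Y|, (fun i => [set x | P x (enum_val i)]), (fun i => [set enum_val i]).
split; [|split].
- move=> i j ij; apply/pred0P => x /=; rewrite !inE; apply/negbTE/negP.
  by move=> /andP[/uP h /h /enum_val_inj/eqP]; apply/negP.
- move=> i j ij; apply/pred0P => y /=; rewrite !inE; apply/negbTE/negP.
  by move=> /andP[/eqP -> /eqP/enum_val_inj/eqP]; apply/negP.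
- move=> x y; case: ifP => Pxy; split => //.
    by move=> _; exists (enum_rank y); rewrite !inE enum_rankK.
  by move=> [i []]; rewrite !inE => + /eqP yE; rewrite -yE Pxy.
Qed.

(** Layer-cake formula, with separate layers for the positive and the negative part. *)
Lemma int_threshold (N : nat) (z : int) : `|z| <= N%:Z ->
  z = \sum_(t < N) ((if (t%:Z < z) then 1 else 0) + -1 * (if (z < - t%:Z) then 1 else 0)).
Proof.
have count (n M : nat) : (n <= M)%N -> \sum_(t < M) (if (t < n)%N then 1 else 0) = n%:Z :> int.
  elim: M n => [|M IH] n; first by rewrite leqn0 big_ord0 => /eqP ->.
  rewrite big_ord_recr /=; case: n => [|n] nM.
    by rewrite big1 // => i _; rewrite ltn0.
  have [->|] := eqVneq n M.
    rewrite ltnSn (eq_bigr (fun=> 1)) => [|i _]; last by rewrite ltnS ltnW.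
    by rewrite sumr_const card_ord; lia.
  by move=> nM'; rewrite IH ?ifN; lia.
move=> zN; rewrite big_split /= -mulr_sumr mulN1r.
have [z0|z0] := leP 0 z.
- rewrite [X in - X]big1 => [|t _]; last by rewrite ifN //; lia.
  rewrite subr0 -[LHS](gez0_abs z0) -(count _ N); last lia.
  by apply: eq_bigr => t _; congr (if _ then _ else _); lia.
- rewrite [X in X - _]big1 => [|t _]; last by rewrite ifN //; lia.
  rewrite add0r; apply: oppr_inj; rewrite opprK -[LHS](ltz0_abs z0) -(count _ N); last lia.
  by apply: eq_bigr => t _; congr (if _ then _ else _); lia.
Qed.

(** Every threshold layer still has at most one nonzero entry per row, hence is blocky; each of the
    [N] thresholds gives one positive and one negative layer. *)
Lemma block_decomp_row_unique (X Y : finType) (h : imat X Y) (N : nat) :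
  (forall x y, `|h x y| <= N%:Z) ->
  (forall x y z, h x y != 0 -> h x z != 0 -> y = z) ->
  block_decomp h (N * 2).
Proof.
move=> hN hu.
have d (t : 'I_N) : block_decomp (fun x y =>
   1 * (if (t%:Z < h x y) then 1 else 0) +
   -1 * (if (h x y < - t%:Z) then 1 else 0)) (1 + 1).
  apply: block_decompD; (apply: block_decomp_signed; [|by auto]);
    by apply: blocky_row_unique => x y z hy hz; apply: (hu x); lia.
have := block_decomp_sum d; rewrite card_ord.
by apply: block_decomp_ext => x y; rewrite [RHS](int_threshold (hN x y)); apply: eq_bigr => t _; rewrite mul1r.
Qed.

(** * Colourings injective on small sets of columns *)

Definition collides (Y C : finType) (f : Y -> C) (A : {set Y}) : bool :=
  [exists p : Y * Y, [&& p.1 \in A, p.2 \in A, p.1 != p.2 & f p.1 == f p.2]].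

(** Recolouring [a] arbitrarily is injective on colourings with [f a = f b], because the old colour
    of [a] can be read off at [b]. *)
Lemma card_collision (Y : finType) (c : nat) (a b : Y) : a != b ->
  (#|[set f : {ffun Y -> 'I_c} | f a == f b]| * c <= #|{ffun Y -> 'I_c}|)%N.
Proof.
move=> ab; rewrite -[X in (_ * X <= _)%N]card_ord -[X in (_ * X <= _)%N]cardsT -cardsX.
pose upd (p : {ffun Y -> 'I_c} * 'I_c) := [ffun y => if y == a then p.2 else p.1 y].
rewrite -(@card_in_imset _ _ upd) ?max_card //.
move=> [f s] [g t]; rewrite !inE !andbT /= => /eqP fab /eqP gab /ffunP e.
have e1 : s = t by have := e a; rewrite !ffunE eqxx.
rewrite e1; congr (_, _); apply/ffunP => y.
have [->|ya] := eqVneq y a; last by have := e y; rewrite !ffunE (negbTE ya).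
by rewrite fab gab; have := e b; rewrite !ffunE eq_sym (negbTE ab).
Qed.

(** Union bound over at most [k ^ 2] ordered pairs, each colliding with probability at most
    [1 / (2 k ^ 2)]. *)
Lemma card_collides (Y : finType) (k : nat) (A : {set Y}) : (#|A| <= k)%N -> (0 < k)%N ->
  (2 * #|[set f : {ffun Y -> 'I_(2 * k ^ 2)} | collides f A]|
    <= #|{ffun Y -> 'I_(2 * k ^ 2)}|)%N.
Proof.
move=> Ak k0; set c := (2 * k ^ 2)%N; set n := #|{ffun _ -> _}|.
have k20 : (0 < k ^ 2)%N by rewrite expn_gt0 k0.
rewrite -(leq_pmul2r k20) -mulnA [(_ * k ^ 2)%N]mulnC mulnA -/c.
pose Q := [set p : Y * Y | [&& p.1 \in A, p.2 \in A & p.1 != p.2]].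
have sub : [set f : {ffun Y -> 'I_c} | collides f A] \subset
    \bigcup_(p in Q) [set f : {ffun Y -> 'I_c} | f p.1 == f p.2].
  apply/fintype.subsetP => f; rewrite inE => /existsP[p /and4P[p1 p2 p12 fp]].
  by apply/bigcupP; exists p; rewrite !inE ?p1 ?p2 ?p12.
have le1 : (#|[set f : {ffun Y -> 'I_c} | collides f A]| <=
    \sum_(p in Q) #|[set f : {ffun Y -> 'I_c} | f p.1 == f p.2]|)%N.
  apply: leq_trans (subset_leq_card sub) _.
  elim/big_rec2: _ => [|p m S _ IH]; first by rewrite cards0.
  by apply: leq_trans (leq_card_setU _ _) _; rewrite leq_add2l.
rewrite mulnC; apply: (@leq_trans (\sum_(p in Q) n)).
  apply: (leq_trans (leq_mul le1 (leqnn c))).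
  rewrite big_distrl /=; apply: leq_sum => p; rewrite inE => /and3P[_ _].
  exact: card_collision.
rewrite sum_nat_const mulnC leq_mul2l; apply/orP; right.
apply: (@leq_trans (#|setX A A|)).
  by apply/subset_leq_card/fintype.subsetP => -[a b]; rewrite !inE /= => /and3P[-> ->].
by rewrite cardsX -mulnn leq_mul.
Qed.

(** First moment: a random colouring collides on each member of [F] with probability at most 1/2, so
    some colouring does no worse than the average. *)
Lemma coloring_halves (Y : finType) (k : nat) (F : {set {set Y}}) : (0 < k)%N ->
  (forall A, A \in F -> (#|A| <= k)%N) ->
  exists f : {ffun Y -> 'I_(2 * k ^ 2)}, (2 * #|[set A in F | collides f A]| <= #|F|)%N.
Proof.
move=> k0 Fk; set c := (2 * k ^ 2)%N.
have c0 : (0 < c)%N by rewrite muln_gt0 expn_gt0 k0.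
case: (boolP [exists f : {ffun Y -> 'I_c}, 2 * #|[set A in F | collides f A]| <= #|F|])%N.
  by move=> /existsP.
rewrite negb_exists => /forallP allbad; exfalso.
have n0 : (0 < #|{ffun Y -> 'I_c}|)%N by apply/card_gt0P; exists [ffun=> Ordinal c0].
have lt1 : (\sum_(f : {ffun Y -> 'I_c}) #|F| < \sum_(f : {ffun Y -> 'I_c}) 2 * #|[set A in F | collides f A]|)%N.
  have /card_gt0P[f0 _] := n0.
  rewrite (bigD1 f0) // [X in (_ < X)%N](bigD1 f0) //= -addSn leq_add //.
    by have := allbad f0; rewrite -ltnNge.
  by apply: leq_sum => f _; have := allbad f; rewrite -ltnNge; exact: ltnW.
have le2 : (\sum_(f : {ffun Y -> 'I_c}) 2 * #|[set A in F | collides f A]| <=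
    \sum_(A in F) #|{ffun Y -> 'I_c}|)%N.
  rewrite -big_distrr /=.
  under eq_bigr => f _ do rewrite -sum1_card.
  under eq_bigr => f _ do under eq_bigl => A do rewrite inE.
  under eq_bigr => f _ do rewrite big_mkcondr.
  rewrite exchange_big /= big_distrr /=; apply: leq_sum => A AF.
  rewrite -big_mkcond sum1_card; apply: leq_trans (card_collides (Fk A AF) k0).
  by rewrite leq_mul2l /= subset_leq_card //; apply/fintype.subsetP => f; rewrite !inE.
by move: (leq_trans lt1 le2); rewrite !sum_nat_const mulnC ltnn.
Qed.

(** Each new colouring at least halves the family not yet served, so nothing remains after [r] of
    them. *)
Lemma colorings_exist (Y : finType) (k r : nat) (F : {set {set Y}}) : (0 < k)%N ->
  (forall A, A \in F -> (#|A| <= k)%N) -> (#|F| < 2 ^ r)%N ->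
  exists f : 'I_r -> {ffun Y -> 'I_(2 * k ^ 2)},
    forall A, A \in F -> exists j, ~~ collides (f j) A.
Proof.
move=> k0; elim: r F => [|r IH] F Fk Fr.
  have c0 : (0 < 2 * k ^ 2)%N by rewrite muln_gt0 expn_gt0 k0.
  exists (fun=> [ffun=> Ordinal c0]) => A AF; suff : (0 < #|F|)%N by lia.
  by apply/card_gt0P; exists A.
have [f hf] := coloring_halves k0 Fk.
pose F' := [set A in F | collides f A].
have [||g hg] := IH F'.
- by move=> A; rewrite inE => /andP[/Fk].
- by move: hf Fr; rewrite -/F' expnS; lia.
exists (fun j => if unlift ord0 j is Some i then g i else f) => A AF.
have [cA|] := boolP (collides f A); last by exists ord0; rewrite unlift_none.
have [|j hj] := hg A; first by rewrite inE AF.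
by exists (lift ord0 j); rewrite liftK.
Qed.

(** A small set is listed in [k] slots, the spare ones holding [None]. *)
Lemma card_small_sets (Y : finType) (k : nat) :
  (#|[set A : {set Y} | #|A| <= k]| <= #|Y|.+1 ^ k)%N.
Proof.
pose im (f : {ffun 'I_k -> option Y}) := [set y | Some y \in codom f].
have sub : [set A : {set Y} | (#|A| <= k)%N] \subset [set im f | f in [set: {ffun 'I_k -> option Y}]].
  apply/fintype.subsetP => A; rewrite inE => Ak; apply/imsetP.
  exists [ffun i : 'I_k => nth None (map Some (enum A)) i] => //.
  apply/setP => y; rewrite inE; apply/idP/idP => [yA|/codomP[i]].
    apply/codomP; have lt : (index y (enum A) < k)%N.
      by apply: leq_trans Ak; rewrite cardE index_mem mem_enum.
    exists (Ordinal lt); rewrite ffunE (nth_map y) /= ?nth_index ?index_mem ?mem_enum //.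
  rewrite ffunE; have [lt|ge] := ltnP i (size (enum A)); last first.
    by rewrite nth_default ?size_map.
  by rewrite (nth_map y) // => -[->]; rewrite -mem_enum mem_nth.
apply: leq_trans (subset_leq_card sub) _; apply: leq_trans (leq_imset_card _ _) _.
by rewrite cardsT card_ffun card_ord card_option.
Qed.

(** Each row gets a colouring injective on its support. Fixing a colouring and a colour leaves at
    most one nonzero entry per row, and there are [r * (2 * k ^ 2)] such pairs. *)
Lemma block_decomp_sparse (X Y : finType) (g : imat X Y) (N k r : nat) :
  (0 < k)%N -> (forall x y, `|g x y| <= N%:Z) ->
  (forall x, #|[set y | g x y != 0%R]| <= k)%N ->
  (#|Y|.+1 ^ k < 2 ^ r)%N ->
  block_decomp g (r * (2 * k ^ 2) * (N * 2)).
Proof.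
move=> k0 gN gk hr.
have [||f hf] := @colorings_exist Y k r [set A : {set Y} | (#|A| <= k)%N] k0.
- by move=> A; rewrite inE.
- exact: leq_ltn_trans (card_small_sets _ _) hr.
have hx x : exists j, ~~ collides (f j) [set y | g x y != 0].
  by apply: hf; rewrite inE.
pose J x := xchoose (hx x).
pose h (i : 'I_r * 'I_(2 * k ^ 2)) x y :=
  if (J x == i.1) && (f (J x) y == i.2) then g x y else 0.
have hd i : block_decomp (h i) (N * 2).
  apply: block_decomp_row_unique => [x y|x y z]; rewrite /h.
    by case: ifP => // _; rewrite normr0.
  case: ifP => // /andP[_ /eqP fy] gy; case: ifP => // /andP[_ /eqP fz] gz.
  apply/eqP; apply: contraNT (xchooseP (hx x)) => yz.
  by apply/existsP; exists (y, z); rewrite !inE gy gz yz /= fy fz.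
have := block_decomp_sum hd; rewrite card_prod !card_ord.
apply: block_decomp_ext => x y.
rewrite (bigD1 (J x, f (J x) y)) //= {1}/h !eqxx big1 ?addr0 // => -[i c] /=.
rewrite /h /= xpair_eqE => ne; rewrite ifN //; apply: contraNN ne => /andP[/eqP -> /eqP ->].
by rewrite !eqxx.
Qed.

(** * Reducing the column norms *)

(** Points with the majority value contribute error [e]; the exceptional ones, a fraction of at most
    [2 * q], contribute up to [2 * N] more. *)
Lemma dot_mean_near (R : realType) k (Y : finType) (v : Y -> 'rV[R]_k)
  (T : {set Y}) u (b : Y -> int) (e q : R) (N : nat) z :
  (forall y, `|dot u (v y) - (b y)%:~R| <= e) ->
  (forall y, `|b y| <= N%:Z) -> z \in T ->
  #|[set y in T | b y != b z]|%:R <= #|T|%:R * (2 * q) ->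
  `|dot u (mean v T) - (b z)%:~R| <= e + 4 * N%:R * q.
Proof.
move=> near bN zT few.
have T0 : 0 < #|T|%:R :> R by rewrite ltr0n; apply/card_gt0P; exists z.
rewrite -(ler_pM2l T0) -[X in X * `|_|]gtr0_norm // -normrM mulrBr.
rewrite dotZr mulrA mulfV ?gt_eqF // mul1r dot_sumr.
rewrite [_ * (b z)%:~R]mulr_natl -[(b z)%:~R *+ _]sumr_const -sumrB.
apply: le_trans (ler_norm_sum _ _ _) _.
apply: (@le_trans _ _ (\sum_(y in T) (e + (if b y != b z then 2 * N%:R else 0)))).
  apply: ler_sum => y _; case: ifPn => [_|].
    apply: le_trans (ler_distD (b y)%:~R _ _) _; rewrite lerD //.
    rewrite -rmorphB /= -intr_norm -natrM pmulrn ler_int.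
    have := bN y; have := bN z; lia.
  by rewrite negbK => /eqP <-; rewrite addr0.
rewrite big_split /= sumr_const -big_mkcondr.
rewrite (eq_bigl (mem [set y in T | b y != b z])) => [|y]; last by rewrite !inE.
rewrite sumr_const -[e *+ _]mulr_natl -[(2 * _) *+ _]mulr_natl mulrDr lerD2l.
have := ler_wpM2r (_ : 0 <= 2 * N%:R) few; rewrite mulr_ge0 // => /(_ isT); lra.
Qed.

Lemma heavy_cluster (R : realType) k (X Y : finType) (u : X -> 'rV[R]_k)
  (v : Y -> 'rV[R]_k) (B : imat X Y) (lam G e : R) (N : nat) :
  0 < lam -> lam <= 1 / 4 -> expR (1 - 1 / (4 * lam)) <= 1 / 4 :> R ->
  (forall x, dot (u x) (u x) <= 1) -> (forall y, dot (v y) (v y) <= G) ->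
  e <= 1 / 8 -> (forall x y, `|dot (u x) (v y) - (B x y)%:~R| <= e) ->
  (forall x y, `|B x y| <= N%:Z) ->
  forall x0 (S : {set Y}), S != set0 -> (forall y, y \in S -> B x0 y != 0) ->
  exists (T : {set Y}) (w : 'rV[R]_k) (g : X -> int),
  [/\ T \subset S, T != set0,
      #|S|%:R * expR (- (G / lam)) <= 2 * #|T|%:R,
      forall y, y \in T -> dot (v y - w) (v y - w) <= dot (v y) (v y) - 1 / 2 &
      forall x, [/\ `|dot (u x) w - (g x)%:~R|
                      <= e + 4 * N%:R * expR (1 - 1 / (4 * lam)),
                    `|g x| <= N%:Z &
                    g x != 0 -> (#|T| <= 2 * #|[set y in T | B x y != 0%R]|)%N]].
Proof.
move=> lam0 lam4; set q := expR _ => q4 u1 vG e8 near BN x0 S S0 Snz.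
pose Sp := [set y in S | 0 < B x0 y]; pose Sm := [set y in S | B x0 y < 0].
have cS : (#|S| <= #|Sp| + #|Sm|)%N.
  have -> : S = Sp :|: Sm.
    apply/setP => y; rewrite !inE -andb_orr; case: (boolP (y \in S)) => //= /Snz.
    by rewrite neq_lt orbC => ->.
  by rewrite cardsU leq_subr.
have nearD x y : dot (u x) (v y) <= (B x y)%:~R + e /\ (B x y)%:~R - e <= dot (u x) (v y).
  by have := near x y; rewrite ler_norml => /andP[]; lra.
(* Restricting to the more frequent sign of row [x0] prevents cancellation: every mean inside [Y0]
   has inner product at least 7/8 in absolute value with [u x0]. *)
have [Y0 [Y0S Y00 cY0 gap]] : exists Y0 : {set Y}, [/\ Y0 \subset S, Y0 != set0,
    (#|S| <= 2 * #|Y0|)%N & forall T : {set Y}, T \subset Y0 -> T != set0 ->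
     49 / 64 <= dot (u x0) (mean v T) ^+ 2].
  have sq (a : R) : 7 / 8 <= a -> 49 / 64 <= a ^+ 2 by nra.
  case: (leqP #|Sm| #|Sp|) => cmp; [exists Sp | exists Sm]; split.
  - by apply/fintype.subsetP => y; rewrite inE => /andP[].
  - by rewrite -card_gt0; move: S0; rewrite -card_gt0; lia.
  - by lia.
  - move=> T /fintype.subsetP TS T0; apply: sq; apply: mean_ge => // y /TS; rewrite inE => /andP[_ B0].
    have [_] := nearD x0 y; have : 1 <= (B x0 y)%:~R :> R by rewrite ler1z; lia.
    lra.
  - by apply/fintype.subsetP => y; rewrite inE => /andP[].
  - by rewrite -card_gt0; move: S0; rewrite -card_gt0; lia.
  - by lia.
  - move=> T /fintype.subsetP TS T0; rewrite -sqrrN -dotNl; apply: sq.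
    apply: mean_ge => // y /TS; rewrite inE => /andP[_ B0]; rewrite dotNl.
    have [+ _] := nearD x0 y; have : (B x0 y)%:~R <= (-1)%:~R :> R by rewrite ler_int; lia.
    lra.
have [T [TY0 clT cT]] := cluster_exists lam0 Y00 vG; have [T0 _] := clT.
have maj x : exists z, (z \in T) && (#|[set y in T | B x y != B x z]|%:R <= #|T|%:R * (2 * q) :> R).
  by have [z zT hz] := cluster_majority lam0 clT (u1 x) e8 (near x); exists z; rewrite zT.
exists T, (mean v T), (fun x => B x (xchoose (maj x))); split=> //.
- exact: fintype.subset_trans TY0 Y0S.
- apply: (@le_trans _ _ (2 * (#|Y0|%:R * expR (- (G / lam))))); last by rewrite ler_pM2l.
  by rewrite mulrA ler_wpM2r ?expR_ge0 // -natrM ler_nat.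
(* The gain is at least [49/64 - lam], which exceeds 1/2. *)
- move=> y yT; have := cluster_dot lam0 clT yT.
  have := le_trans (gap _ TY0 T0) (dot_sqr_le _ (u1 x0)); lra.
move=> x; have /andP[] := xchooseP (maj x); set z := xchoose _ => zT hz; split=> //.
  exact: dot_mean_near (near x) (BN x) zT hz.
move=> Bz.
(* Zeros of row [x] in [T] differ from the nonzero majority value, so they fill at most
   [2 * q <= 1/2] of [T]. *)
have : #|T :\: [set y in T | B x y != 0%R]|%:R <= #|T|%:R * (1 / 2) :> R.
  apply: (@le_trans _ _ #|[set y in T | B x y != B x z]|%:R).
    rewrite ler_nat subset_leq_card //; apply/fintype.subsetP => y; rewrite !inE.
    by case: (y \in T); rewrite ?andbF //= andbT negbK => /eqP ->; rewrite eq_sym.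
  by apply: le_trans hz _; rewrite ler_wpM2l //; lra.
rewrite cardsD (setIidPr _); last by apply/fintype.subsetP => y; rewrite inE => /andP[].
have : (#|[set y in T | B x y != 0%R]| <= #|T|)%N.
  by apply/subset_leq_card/fintype.subsetP => y; rewrite inE => /andP[].
move=> le; rewrite natrB // -(ler_nat R) natrM; lra.
Qed.

(* A cluster is named by one of its points: [l y] is the name of the cluster of
   [y], and column [l y] of [g] holds the values subtracted on that cluster. *)
Lemma cluster_stage (R : realType) k (X Y : finType) (u : X -> 'rV[R]_k)
  (v : Y -> 'rV[R]_k) (B : imat X Y) (lam G e : R) (N : nat) :
  0 < lam -> lam <= 1 / 4 -> expR (1 - 1 / (4 * lam)) <= 1 / 4 :> R ->
  (forall x, dot (u x) (u x) <= 1) -> (forall y, dot (v y) (v y) <= G) ->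
  e <= 1 / 8 -> (forall x y, `|dot (u x) (v y) - (B x y)%:~R| <= e) ->
  (forall x y, `|B x y| <= N%:Z) ->
  forall (D : nat) (S : {set Y}),
  exists (Z : {set Y}) (l : Y -> Y) (w : Y -> 'rV[R]_k) (g : imat X Y),
  [/\ Z \subset S,
      forall y, y \in Z -> l y \in Z /\
        dot (v y - w y) (v y - w y) <= dot (v y) (v y) - 1 / 2,
      forall x y, y \in Z -> `|dot (u x) (w y) - (g x (l y))%:~R|
                      <= e + 4 * N%:R * expR (1 - 1 / (4 * lam)),
      forall x y, `|g x y| <= N%:Z /\ (y \notin Z -> g x y = 0) &
      forall x,
       (2 * #|[set y in S :\: Z | B x y != 0%R]| <= D)%N /\
       #|[set y | g x y != 0%R]|%:R * (D%:R * expR (- (G / lam))) <=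
         8 * #|[set y in Z | B x y != 0%R]|%:R].
Proof.
move=> lam0 lam4 q4 u1 vG e8 near BN D.
have heavy := heavy_cluster lam0 lam4 q4 u1 vG e8 near BN.
set q := expR (1 - _) in heavy *; set del := expR (- _) in heavy *.
have del0 : 0 <= del by exact: expR_ge0.
(* Greedy choice, by induction on the size of [S]: as long as some row has more than [D / 2] nonzero
   entries on [S], a cluster is removed. *)
move=> S; have [n] := ubnP #|S|; elim: n S => // n IH S Sn.
have [/existsP[x0 bx0]|] := boolP [exists x, D < 2 * #|[set y in S | B x y != 0%R]|]%N; last first.
  rewrite negb_exists => /forallP small.
  exists set0, id, (fun=> 0), (fun _ _ => 0); split.
  - exact: sub0set.
  - by move=> y; rewrite inE.
  - by move=> x y; rewrite inE.
  - by move=> x y; rewrite normr0.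
  - move=> x; have := small x; rewrite -leqNgt setD0 => ->; split=> //.
    have -> : [set _ : Y | (0 : int) != 0%R] = set0 by apply/setP => y; rewrite !inE eqxx.
    by rewrite cards0 mul0r mulr_ge0.
set S1 := [set y in S | B x0 y != 0%R] in bx0.
have S1S : S1 \subset S by apply/fintype.subsetP => y; rewrite inE => /andP[].
have [||T [w1 [g1 [TS1 T0 cT w1P g1P]]]] := heavy x0 S1.
- by rewrite -card_gt0; lia.
- by move=> y; rewrite inE => /andP[].
have TS : T \subset S by exact: fintype.subset_trans TS1 S1S.
have [|Z [l [w [g [ZS lP wP gP degP]]]]] := IH (S :\: T).
  move: T0 Sn; rewrite cardsD (setIidPr TS) -card_gt0.
  by move: (subset_leq_card TS); clear; lia.
have ZT y : y \in Z -> y \notin T by move/(fintype.subsetP ZS); rewrite inE => /andP[].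
have [y0 y0T] := set0Pn _ T0.
have y0Z : y0 \notin Z by apply/negP => /ZT; rewrite y0T.
exists (T :|: Z), (fun y => if y \in T then y0 else l y),
  (fun y => if y \in T then w1 else w y),
  (fun x y => if y == y0 then g1 x else g x y).
split.
- rewrite subUset TS; apply: fintype.subset_trans ZS _; exact: subsetDl.
- move=> y; rewrite !inE; case: (boolP (y \in T)) => [yT _|yT /= /lP[-> ?]].
    by rewrite y0T; split=> //; exact: w1P.
  by rewrite orbT.
- move=> x y; rewrite inE; case: (boolP (y \in T)) => [yT _|yT /= yZ].
    by rewrite eqxx; have [] := g1P x.
  by rewrite ifN ?wP //; apply: contraTneq (proj1 (lP _ yZ)) => ->.
- move=> x y; case: eqP => [->|_]; rewrite inE; first by rewrite y0T; split=> //; have [] := g1P x.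
  by have [? h] := gP x y; split=> //; rewrite negb_or => /andP[_ /h].
- move=> x; have [d1 d2] := degP x; split.
    by rewrite -setDDl.
  have [_ _ g1x] := g1P x.
  have cardU : #|[set y in T :|: Z | B x y != 0%R]| =
      (#|[set y in T | B x y != 0%R]| + #|[set y in Z | B x y != 0%R]|)%N.
    rewrite -cardsUI [X in (_ + X)%N]eq_card0 ?addn0 => [|y]; last first.
      rewrite !inE; apply/negP => /andP[/andP[yT _] /andP[/ZT]].
      by rewrite yT.
    by apply: eq_card => y; rewrite !inE andb_orl.
  have gy0 : g x y0 = 0 by have [_ ->] := gP x y0.
  have cardg : #|[set y | (if y == y0 then g1 x else g x y) != 0%R]| =
      ((g1 x != 0%R) + #|[set y | g x y != 0%R]|)%N.
    rewrite (cardsD1 y0) inE eqxx; congr (_ + _)%N; apply: eq_card => y; rewrite !inE.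
    by have [->|] := eqVneq y y0; rewrite ?gy0 ?eqxx.
  rewrite cardU cardg !natrD mulrDl mulrDr lerD //.
  have [_|g1n0] := eqVneq (g1 x) 0; first by rewrite mul0r mulr_ge0.
  (* Charging: a cluster with [g1 x] nonzero adds one entry to row [x] of the new matrix and covers
     at least [#|T| / 2] nonzero entries of [B]. Then [D * del <= 2 #|S1| del <= 4 #|T|], which
     explains the factor 8. *)
  have h1 : #|T|%:R <= 2 * #|[set y in T | B x y != 0%R]|%:R :> R.
    by rewrite -natrM ler_nat g1x.
  have h2 : D%:R <= 2 * #|S1|%:R :> R by rewrite -natrM ler_nat ltnW.
  have h3 := ler_wpM2r del0 h2; rewrite mul1r; lra.
Qed.

(** Induction on [j]: one stage halves the bound on the row degrees, and the charging inequality
    leaves at most [K] nonzero entries in each row of its [g]. *)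
Lemma level_decomp (R : realType) k (X Y : finType) (u : X -> 'rV[R]_k)
  (v : Y -> 'rV[R]_k) (B : imat X Y) (lam G e : R) (N K r : nat) :
  0 < lam -> lam <= 1 / 4 -> expR (1 - 1 / (4 * lam)) <= 1 / 4 :> R ->
  (forall x, dot (u x) (u x) <= 1) -> (forall y, dot (v y) (v y) <= G) ->
  e <= 1 / 8 -> (forall x y, `|dot (u x) (v y) - (B x y)%:~R| <= e) ->
  (forall x y, `|B x y| <= N%:Z) ->
  8 <= K%:R * expR (- (G / lam)) :> R -> (#|Y|.+1 ^ K < 2 ^ r)%N ->
  forall (j : nat) (S : {set Y}),
  (forall x, #|[set y in S | B x y != 0%R]| < 2 ^ j)%N ->
  exists (Z : {set Y}) (w : Y -> 'rV[R]_k) (F : imat X Y),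
  [/\ Z \subset S,
      forall y, y \in Z -> dot (v y - w y) (v y - w y) <= dot (v y) (v y) - 1 / 2,
      forall x y, (y \in Z -> `|dot (u x) (w y) - (F x y)%:~R|
             <= e + 4 * N%:R * expR (1 - 1 / (4 * lam))) /\
        (y \notin Z -> F x y = 0),
      forall x y, y \in S -> y \notin Z -> B x y = 0 &
      block_decomp F (j * (r * (2 * K ^ 2) * (N * 2)))].
Proof.
move=> lam0 lam4 q4 u1 vG e8 near BN HK Hr.
have stage := cluster_stage lam0 lam4 q4 u1 vG e8 near BN.
set q := expR (1 - _) in stage *; set del := expR (- _) in stage HK.
have del0 : 0 < del by exact: expR_gt0.
have K0 : (0 < K)%N by rewrite lt0n; apply/eqP => K0; move: HK; rewrite K0; lra.
elim=> [|j IH] S Sdeg.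
  exists set0, (fun=> 0), (fun _ _ => 0); split.
  - exact: sub0set.
  - by move=> y; rewrite inE.
  - by move=> x y; rewrite inE.
  - move=> x y yS _; apply/eqP; apply: contraTT (Sdeg x) => By.
    by rewrite expn0 -leqNgt card_gt0; apply/set0Pn; exists y; rewrite inE yS.
  - exact: block_decomp0.
have pow_gt0 : (0 < 2 ^ j)%N by rewrite expn_gt0.
(* With the predecessor of the power, [2 * degree <= D] means [degree < 2 ^ j], while [D] stays
   positive and bounds the present degrees. *)
have [Z [l [w [g [ZS lP wP gP degP]]]]] := stage (2 ^ j.+1).-1 S.
have [|Z' [w' [F' [Z'S w'P F'P S'0 dF']]]] := IH (S :\: Z).
  move=> x; have [d _] := degP x; move: d pow_gt0; rewrite expnS; clear; lia.
have Z'Z y : y \in Z' -> y \notin Z by move/(fintype.subsetP Z'S); rewrite inE => /andP[].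
have dF : block_decomp (fun x y => if y \in Z then g x (l y) else 0)
    (r * (2 * K ^ 2) * (N * 2)).
  apply: (block_decomp_comp (mem Z) l); apply: block_decomp_sparse => //.
    by move=> x y; have [] := gP x y.
  move=> x; have [_ d] := degP x; set D := (2 ^ j.+1).-1 in d.
  have sub : (#|[set y in Z | B x y != 0%R]| <= D)%N.
    apply: (@leq_trans #|[set y in S | B x y != 0%R]|).
      apply/subset_leq_card/fintype.subsetP => y; rewrite !inE => /andP[/(fintype.subsetP ZS) -> ->] //.
    by rewrite /D; move: (Sdeg x) pow_gt0; clear; lia.
  have D0 : 0 < D%:R :> R.
    by rewrite ltr0n /D expnS; move: pow_gt0; clear; lia.
  rewrite -(ler_nat R) -(ler_pM2r (mulr_gt0 D0 del0)).
  apply: le_trans d _; apply: (@le_trans _ _ (8 * D%:R)).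
    by rewrite ler_pM2l // ler_nat.
  by rewrite mulrCA [X in X <= _]mulrC ler_pM2l.
exists (Z :|: Z'), (fun y => if y \in Z then w y else w' y),
  (fun x y => (if y \in Z then g x (l y) else 0) + F' x y).
split.
- by rewrite subUset ZS (fintype.subset_trans Z'S) // subsetDl.
- move=> y; rewrite inE; case: (boolP (y \in Z)) => /= [yZ _|_ /w'P //].
  by have [] := lP y yZ.
- move=> x y; rewrite inE; case: (boolP (y \in Z)) => /= yZ.
    have [_ ->] := F'P x y; last by apply: contraL yZ => /Z'Z.
    by rewrite addr0; split=> // _; exact: wP.
  by rewrite add0r; exact: F'P.
- move=> x y yS; rewrite inE negb_or => /andP[yZ yZ']; apply: S'0 => //.
  by rewrite inE yZ.
- by rewrite mulSn; apply: block_decompD.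
Qed.

(** Induction on the number [L] of rounds. A round lowers the squared norm of every nonzero column
    by 1/2 and turns the error [e] into [2 * e + tau], where [tau = 4 * N * q]; thus [e + tau]
    exactly doubles, as the smallness hypothesis anticipates. *)
Lemma levels_decomp (R : realType) k (X Y : finType) (u : X -> 'rV[R]_k)
  (lam G : R) (N K r j : nat) :
  0 < lam -> lam <= 1 / 4 -> expR (1 - 1 / (4 * lam)) <= 1 / 4 :> R ->
  (forall x, dot (u x) (u x) <= 1) ->
  8 <= K%:R * expR (- (G / lam)) :> R -> (#|Y|.+1 ^ K < 2 ^ r)%N ->
  (#|Y| < 2 ^ j)%N -> (0 < N)%N -> G <= (N%:R - 1) ^+ 2 ->
  forall (L : nat) (v : Y -> 'rV[R]_k) (B : imat X Y) (e : R),
  (forall y, dot (v y) (v y) <= G) ->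
  (forall x y, `|dot (u x) (v y) - (B x y)%:~R| <= e) ->
  2 ^+ L * (e + 4 * N%:R * expR (1 - 1 / (4 * lam))) <= 1 / 8 ->
  (forall y, (forall x, B x y = 0) \/ dot (v y) (v y) <= (L%:R + 1) / 2) ->
  block_decomp B (L * (j * (r * (2 * K ^ 2) * (N * 2)))).
Proof.
move=> lam0 lam4 q4 u1 HK Hr Hj N0 GN; set q := expR (1 - _).
have tau0 : 0 <= 4 * N%:R * q by rewrite !mulr_ge0 ?expR_ge0.
elim=> [|L IH] v B e vG near small cols.
  rewrite mul0n; apply: block_decomp_ext (block_decomp0 X Y) => x y /=.
  (* A nonzero entry would force an inner product of size at least 7/8, but its square is at most
     1/2. *)
  apply/esym; case: (cols y) => [//|vy].
  have := le_trans (dot_sqr_le (v y) (u1 x)) vy; have := near x y; set d := dot _ _.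
  rewrite ler_norml => /andP[n1 n2] dd; move: small; rewrite expr0 mul1r => small.
  apply/eqP; apply: contraTT isT => Bn0.
  have [B0|B0] : 1 <= B x y \/ B x y <= -1 by move: Bn0; clear; lia.
    have : 1 <= (B x y)%:~R :> R by rewrite ler1z.
    move=> ?; have : 7 / 8 <= d by lra.
    nra.
  have : (B x y)%:~R <= (-1)%:~R :> R by rewrite ler_int.
  move=> ?; have : d <= - (7 / 8) by lra.
  nra.
have e8 : e <= 1 / 8.
  have : 1 <= 2 ^+ L.+1 :> R by rewrite exprn_ege1 // ler1n.
  have [|et] := leP (e + 4 * N%:R * q) 0; first by lra.
  by have := ler_wpM2r (ltW et); move=> h /h; lra.
have BN x y : `|B x y| <= N%:Z.
  rewrite -(ler_int R) intr_norm.
  have d2 := le_trans (le_trans (dot_sqr_le (v y) (u1 x)) (vG y)) GN.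
  have N1 : 0 <= N%:R - 1 :> R by rewrite subr_ge0 ler1n.
  have := near x y; move: d2; rewrite -[leLHS]real_normK ?num_real // ler_sqr ?nnegrE // => d2 nr.
  have := ler_distD 0 (B x y)%:~R (dot (u x) (v y)).
  have := ler_normB (dot (u x) (v y)) (dot (u x) (v y) - (B x y)%:~R).
  rewrite opprB addrC subrK; move: d2 nr; rewrite pmulrn; lra.
pose S := [set y | [exists x, B x y != 0%R]].
have [|Z [w [F [ZS wP FP S0 dF]]]] := level_decomp lam0 lam4 q4 u1 vG e8 near BN HK Hr (j := j) (S := S).
  by move=> x; apply: leq_ltn_trans Hj; exact: max_card.
pose v' y := if y \in Z then v y - w y else v y.
rewrite mulSn; apply: block_decomp_ext (block_decompD dF (IH v' (fun x y => B x y - F x y) (2 * e + 4 * N%:R * q) _ _ _ _)).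
- by move=> x y; rewrite addrC subrK.
- move=> y; rewrite /v'; case: ifP => // /wP h; apply: le_trans h _.
  by have := vG y; lra.
- move=> x y; rewrite /v'; have [n2 F0] := FP x y; have n1 := near x y; case: ifPn => yZ.
    move: n2 => /(_ yZ) n2; rewrite dotDr dotNr rmorphB /=.
    have := ler_normB (dot (u x) (v y) - (B x y)%:~R) (dot (u x) (w y) - (F x y)%:~R).
    set p := _ - _ - (_ - _); have -> : p = dot (u x) (v y) - dot (u x) (w y) - ((B x y)%:~R - (F x y)%:~R).
      by rewrite /p; ring.
    by rewrite -/q in n2; lra.
  rewrite (F0 yZ) subr0; apply: le_trans n1 _.
  have := le_trans (normr_ge0 _) (near x y); lra.
- by move: small; rewrite exprS; lra.
- move=> y; rewrite /v'; case: ifPn => yZ.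
    right; have := wP y yZ; case: (cols y) => [B0|].
      move/(fintype.subsetP ZS): yZ; rewrite inE => /existsP[x].
      by rewrite B0 eqxx.
    by rewrite -natr1; lra.
  left=> x; have [_ ->] := FP x y; rewrite // subr0.
  have [yS|] := boolP (y \in S); first exact: S0.
  by rewrite inE negb_exists => /forallP/(_ x); rewrite negbK => /eqP.
Qed.

(** * Choice of the constants *)

Lemma ln2_le1 (R : realType) : ln 2 <= 1 :> R.
Proof. by have := @ln_le_sub1 R 2; rewrite ltr0n => /(_ isT); lra. Qed.

Lemma ln2_ge_half (R : realType) : 1 / 2 <= ln 2 :> R.
Proof.
have := @ln_le_sub1 R 2^-1; rewrite lnV ?posrE ?ltr0n // invr_gt0 ltr0n => /(_ isT).
lra.
Qed.

Lemma pow2_le_expR (R : realType) (n : nat) : 2 ^+ n <= expR n%:R :> R.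
Proof.
rewrite -[n%:R]mulr1 expRM_natl lerXn2r ?nnegrE ?expR_ge0 ?ler0n //.
by have := expR_ge1Dx (1 : R); lra.
Qed.

(** The first term is at most [2^(-8 G) <= 1/16]. For the second, [2^L <= exp (2 G)] and
    [4 N <= 8 exp G] leave [8 exp (1 - 17 G) <= 8 / 2^7]. *)
Lemma error_budget (R : realType) (G e : R) (L N : nat) :
  1 / 2 <= G -> L%:R <= 2 * G -> N%:R <= G + 2 -> e <= 2 `^ (- (10 * G)) ->
  2 ^+ L * (e + 4 * N%:R * expR (1 - 20 * G)) <= 1 / 8.
Proof.
move=> G2 LG NG eG.
have l1 := ln2_le1 R; have l2 := ln2_ge_half R.
have p20 : 0 <= 2 ^+ L :> R by rewrite exprn_ge0.
have pL : 2 ^+ L <= expR (2 * G * ln 2) :> R.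
  by rewrite -{1}(@lnK R 2) ?posrE // -expRM_natl ler_expR ler_wpM2r //; lra.
have e1 : 2 ^+ L * e <= 1 / 16.
  apply: le_trans (ler_wpM2l p20 eG) _.
  rewrite /powR ifF; last by apply/negbTE; rewrite pnatr_eq0.
  apply: le_trans (ler_wpM2r (expR_ge0 _) pL) _; rewrite -expRD.
  apply: (@le_trans _ _ (expR (- (4%:R * ln 2)))); first by rewrite ler_expR; nra.
  by rewrite expRN expRM_natl lnK ?posrE //; lra.
have e2 : 2 ^+ L * (4 * N%:R * expR (1 - 20 * G)) <= 1 / 16.
  have pL' : 2 ^+ L <= expR (2 * G) :> R.
    apply: le_trans pL _; rewrite ler_expR; nra.
  have N2 : 4 * N%:R <= 8 * expR G :> R.
    by have := expR_ge1Dx G; lra.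
  apply: (@le_trans _ _ (expR (2 * G) * (8 * expR G * expR (1 - 20 * G)))).
    apply: ler_pM => //; first by rewrite !mulr_ge0 ?expR_ge0.
    by rewrite ler_wpM2r ?expR_ge0.
  have -> : expR (2 * G) * (8 * expR G * expR (1 - 20 * G)) = 8 * expR (1 - 17 * G).
    have -> : 1 - 17 * G = 2 * G + G + (1 - 20 * G) by ring.
    by rewrite !expRD; ring.
  have : expR (1 - 17 * G) <= (2 ^+ 7)^-1 :> R.
    apply: (@le_trans _ _ (expR (- 7%:R))); first by rewrite ler_expR; lra.
    by rewrite expRN lef_pV2 ?posrE ?exprn_gt0 ?expR_gt0 // pow2_le_expR.
  lra.
by rewrite mulrDr; lra.
Qed.

(** There are [O(G)] rounds of [j = O(ln #|Y|)] levels. A level costs [r * (2 * K ^ 2) * (N * 2)]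
    with [K = O(E)] and [r = O(E * ln #|Y|)], hence the cube of [E] and the square of the
    logarithm. *)
Lemma block_decomp_log (R : realType) k (X Y : finType) (u : X -> 'rV[R]_k)
  (v : Y -> 'rV[R]_k) (B : imat X Y) (G e : R) :
  (1 < #|Y|)%N -> 1 / 2 <= G ->
  (forall x, dot (u x) (u x) <= 1) -> (forall y, dot (v y) (v y) <= G) ->
  (forall x y, `|dot (u x) (v y) - (B x y)%:~R| <= e) ->
  e <= 2 `^ (- (10 * G)) ->
  exists2 L : nat, block_decomp B L &
    L%:R <= expR (320 * G ^+ 2) * ln #|Y|%:R ^+ 2 :> R.
Proof.
move=> Y1 G2 u1 vG near eG.
have G0 : 0 < G by lra.
(* [lam] is so small that the exceptional fraction [expR (1 - 20 * G)] survives
   [2 * G] doublings of the error. *)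
pose lam := 1 / (80 * G); pose E := expR (80 * G ^+ 2).
have lam0 : 0 < lam by rewrite divr_gt0 ?mulr_gt0.
have lamq : 1 / (4 * lam) = 20 * G by rewrite /lam; field; rewrite gt_eqF.
have lamE : G / lam = 80 * G ^+ 2 by rewrite /lam; field; rewrite gt_eqF.
have E1 : 1 <= E by rewrite -expR0 ler_expR mulr_ge0 ?sqr_ge0.
(* [N] satisfies [G <= (N - 1)^2], [L] satisfies [G <= (L + 1) / 2], and [K] satisfies [8 <= K / E].
   As [#|Y| < 2 ^ j], there are at most [2 ^ (j * K)] supports to colour. *)
pose N := (Num.truncn G).+2; pose L := Num.truncn (2 * G).
pose K := (Num.truncn (8 * E)).+1; pose j := (trunc_log 2 #|Y|).+1.
pose r := (j * K).+1.
have /andP[tG1 tG2] := truncn_itv (ltW G0).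
have G20 : 0 <= 2 * G by rewrite mulr_ge0 ?ltW.
have E80 : 0 <= 8 * E by rewrite mulr_ge0 ?expR_ge0.
have /andP[tL1 tL2] := truncn_itv G20; have /andP[tK1 tK2] := truncn_itv E80.
have NE : N%:R = (Num.truncn G)%:R + 2 :> R by rewrite /N -addn2 natrD.
have KE : K%:R = (Num.truncn (8 * E))%:R + 1 :> R by rewrite /K -addn1 natrD.
have NG : N%:R <= G + 2 by rewrite NE lerD2r.
have q128 : expR (1 - 1 / (4 * lam)) <= 1 / 4 :> R.
  apply: (@le_trans _ _ (expR (- 2%:R))); first by rewrite ler_expR lamq; lra.
  rewrite expRN; apply: (@le_trans _ _ (2 ^+ 2)^-1); last by lra.
  by rewrite lef_pV2 ?posrE ?exprn_gt0 ?expR_gt0 // pow2_le_expR.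
have Yj : (#|Y| < 2 ^ j)%N by exact: trunc_log_ltn.
exists (L * (j * (r * (2 * K ^ 2) * (N * 2))))%N.
  apply: (levels_decomp lam0 _ q128 u1 _ _ Yj _ _ vG near).
  - by rewrite /lam ler_pdivrMr ?mulr_gt0 //; lra.
  - rewrite lamE expRN -/E ler_pdivlMr ?expR_gt0 //; first by rewrite KE -natr1 in tK2 *; exact: ltW.
  - by apply: (@leq_ltn_trans (2 ^ (j * K))); [rewrite expnM leq_exp2r | rewrite ltn_exp2l].
  - by [].
  - rewrite NE; have : 0 <= (Num.truncn G)%:R :> R by []; rewrite -natr1 in tG2; nra.
  - by rewrite lamq; exact: error_budget.
  - by move=> y; right; apply: le_trans (vG y) _; rewrite -natr1 in tL2; lra.
have l2 := ln2_ge_half R.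
have Y0 : 0 < #|Y|%:R :> R by rewrite ltr0n ltnW.
set l := ln #|Y|%:R.
have ln2l : ln 2 <= l by rewrite ler_ln ?posrE // ler_nat.
(* The successor in [j] is absorbed because [l >= ln 2 >= 1/2]. *)
have jl : j%:R <= 4 * l.
  have : (trunc_log 2 #|Y|)%:R * ln 2 <= l.
    rewrite mulr_natl -lnXn // ler_ln ?posrE ?exprn_gt0 // -natrX ler_nat.
    by rewrite trunc_logP // ltnW.
  rewrite /j -natr1; have : 0 <= (trunc_log 2 #|Y|)%:R :> R by [].
  by nra.
have rj : r%:R <= 2 * j%:R * K%:R :> R.
  rewrite -!natrM ler_nat /r -mulnA mul2n -addnn -addn1 leq_add2l muln_gt0.
  by rewrite /j /K.
have KE9 : K%:R <= 9 * E by rewrite KE; lra.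
have l0 : 0 < l by lra.
have E0 : 0 < E by lra.
have rb : r%:R <= 72 * l * E.
  apply: le_trans rj _.
  have -> : 72 * l * E = (2 * (4 * l)) * (9 * E) by ring.
  by apply: ler_pM => //; [rewrite mulr_ge0 | rewrite ler_pM2l].
have K2 : 2 * K%:R ^+ 2 <= 2 * (9 * E) ^+ 2.
  by rewrite ler_pM2l // lerXn2r ?nnegrE // mulr_ge0 // ltW.
rewrite !natrM -[K%:R * K%:R]expr2.
apply: (@le_trans _ _ (2 * G * (4 * l * (72 * l * E * (2 * (9 * E) ^+ 2) * ((G + 2) * 2))))).
  have chain (a b c d f a' b' c' d' f' : R) : 0 <= a -> 0 <= b -> 0 <= c ->
      0 <= d -> 0 <= f -> a <= a' -> b <= b' -> c <= c' -> d <= d' -> f <= f' ->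
      a * (b * (c * d * f)) <= a' * (b' * (c' * d' * f')).
    move=> a0 b0 c0 d0 f0 aa bb cc dd ff.
    have cd : c * d <= c' * d' by exact: ler_pM.
    have cdf : c * d * f <= c' * d' * f' by apply: ler_pM => //; exact: mulr_ge0.
    have cdf0 : 0 <= c * d * f by rewrite !mulr_ge0.
    by apply: ler_pM => //; [exact: mulr_ge0 | exact: ler_pM].
  have K20 : 0 <= 2 * K%:R ^+ 2 :> R by rewrite mulr_ge0 ?exprn_ge0.
  have N20 : 0 <= N%:R * 2 :> R by rewrite mulr_ge0.
  apply: chain (ler0n _ _) (ler0n _ _) (ler0n _ _) K20 N20 tL1 jl rb K2 _.
  by rewrite ler_pM2r.
have regroup (c d : R) : 2 * G * (4 * l * (c * l * E * (2 * (d * E) ^+ 2) * ((G + 2) * 2))) =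
  32 * c * d ^+ 2 * (G * (G + 2)) * E ^+ 3 * l ^+ 2 by ring.
rewrite regroup ler_wpM2r ?sqr_ge0 //.
(* The first summand pays for the numerical constants, the second for [G * (G + 2)], and the third
   is the cube of [E]. *)
have -> : 320 * G ^+ 2 = 76 * G ^+ 2 + 4 * G ^+ 2 + 3%:R * (80 * G ^+ 2) by ring.
rewrite !expRD [expR (3 * _)]expRM_natl -/E ler_wpM2r ?exprn_ge0 ?expR_ge0 //.
have consts : 32 * 72 * 9 ^+ 2 <= expR (76 * G ^+ 2) :> R.
  apply: (@le_trans _ _ (2 ^+ 5 * 2 ^+ 7 * 2 ^+ 7)).
    have p n m : (n <= 2 ^ m)%N -> n%:R <= 2 ^+ m :> R by rewrite -natrX ler_nat.
    have q9 : 9 ^+ 2 <= 2 ^+ 7 :> R by rewrite -natrX p.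
    by apply: ler_pM; rewrite ?mulr_ge0 ?exprn_ge0 //; apply: ler_pM; rewrite ?p.
  rewrite -!exprD; apply: le_trans (pow2_le_expR _ _) _; rewrite ler_expR.
  by rewrite [_%:R](_ : _ = 19) //; nra.
apply: ler_pM => //; first by rewrite !mulr_ge0 ?exprn_ge0.
  by rewrite mulr_ge0 ?addr_ge0 ?(ltW G0).
apply: (@le_trans _ _ (expR G ^+ 2)).
  have := expR_ge1Dx G; set x := expR G; nra.
by rewrite -expRM_natl ler_expR; nra.
Qed.

(** [gamma2] is an infimum, so a factorization is taken for some [c] above [gamma]; the factor 2
    leaves room for this. *)
Lemma sqr_slack (R : realType) (g : R) : 0 < g ->
  exists2 c, g < c & c ^+ 2 <= 2 * g ^+ 2.
Proof. by move=> g0; exists (5 / 4 * g); nra. Qed.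

(** The left exponent is [1280 g^4]. Since [g^7 >= g^4 / 8] and [ln 2 >= 1/2], the constant
    [16 * 1280 = 20 * 2^10] suffices. *)
Lemma exponent_comparison (R : realType) (g : R) : 1 / 2 <= g ->
  expR (320 * (2 * g ^+ 2) ^+ 2) <= 2 `^ (20 * 2 ^+ 10 * g ^+ 7).
Proof.
move=> gge; rewrite /powR ifF; last by apply/negbTE; rewrite pnatr_eq0.
rewrite ler_expR; have l2 := ln2_ge_half R.
have g3 : 1 / 8 <= g ^+ 3.
  have : (1 / 2) ^+ 3 <= g ^+ 3 by rewrite lerXn2r ?nnegrE //; lra.
  lra.
have g4 : 0 <= g ^+ 4 by rewrite exprn_ge0 //; lra.
have g7 : 1 / 8 * g ^+ 4 <= g ^+ 7 by rewrite [g ^+ 7](exprD _ 3 4) ler_wpM2r.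
have h : 1 / 16 * g ^+ 4 <= g ^+ 7 * ln 2.
  apply: le_trans (_ : 1 / 8 * g ^+ 4 * (1 / 2) <= _); first lra.
  by apply: ler_pM => //; lra.
have c0 : 0 <= 20 * 2 ^+ 10 :> R by rewrite mulr_ge0 ?exprn_ge0.
rewrite -mulrA; apply: le_trans (ler_wpM2l c0 h).
by rewrite exprMn -exprM !exprS expr0; lra.
Qed.

Lemma two_sqr_ge_half (R : realType) (g : R) : 1 / 2 <= g -> 1 / 2 <= 2 * g ^+ 2.
Proof. nra. Qed.

(** * The factorization norm *)

(* Imported only now: the classical set theory shadows the names of finset. *)
From mathcomp Require Import all_classical all_reals all_analysis.
From mathcomp Require Import Rstruct Rstruct_topology.
From Stdlib Require Import Rdefinitions.

Lemma bigmax_sqrt_ge0 (I : finType) (f : I -> R) :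
  0 <= \big[Order.max/0]_(x : I) Num.sqrt (f x).
Proof.
by elim/big_rec: _ => // i x _ x0; rewrite le_max x0 orbT.
Qed.

Lemma le_sqr_bigmax_sqrt (I : finType) (f : I -> R) x : 0 <= f x ->
  f x <= (\big[Order.max/0]_(x : I) Num.sqrt (f x)) ^+ 2.
Proof.
move=> f0; rewrite -[leLHS]sqr_sqrtr // lerXn2r ?nnegrE ?sqrtr_ge0 ?bigmax_sqrt_ge0 //.
exact: (le_bigmax _ (fun x => Num.sqrt (f x))).
Qed.

(** Moving the row norm [a] of [U] over to [V] makes the row vectors at most unit and the column
    vectors at most [a * b < c] long. *)
Lemma gamma2_vectors (X Y : finType) (A : rmat X Y) (c : R) : gamma2 A < c ->
  exists (k : nat) (u : X -> 'rV[R]_k) (v : Y -> 'rV[R]_k),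
    [/\ forall x y, A x y = dot (u x) (v y), forall x, dot (u x) (u x) <= 1 &
        forall y, dot (v y) (v y) <= c ^+ 2].
Proof.
move=> Ac.
have [|r [k [U [V [AE ->]]]] rc] := inf_lt _ Ac.
  (* The set of values is nonempty: [A] times the identity is a factorization. *)
  exists (row_norm (fun x (i : 'I_#|Y|) => A x (enum_val i)) *
          col_norm (fun (i : 'I_#|Y|) y => (i == enum_rank y)%:R)).
  do 3!eexists; split; last reflexivity.
  move=> x y; rewrite (bigD1 (enum_rank y)) //= enum_rankK eqxx mulr1 big1 ?addr0 //.
  by move=> i /negbTE ->; rewrite mulr0.
have rowE x : \sum_(i < k) U x i ^+ 2 <= row_norm U ^+ 2.
  have := @le_sqr_bigmax_sqrt _ (fun x => \sum_(i < k) U x i ^+ 2) x; apply.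
  by apply: sumr_ge0 => i _; exact: sqr_ge0.
have colE y : \sum_(i < k) V i y ^+ 2 <= col_norm V ^+ 2.
  have := @le_sqr_bigmax_sqrt _ (fun y => \sum_(i < k) V i y ^+ 2) y; apply.
  by apply: sumr_ge0 => i _; exact: sqr_ge0.
have a0 : 0 <= row_norm U by exact: bigmax_sqrt_ge0.
have b0 : 0 <= col_norm V by exact: bigmax_sqrt_ge0.
move: a0 b0 rowE colE rc; set a := row_norm U; set b := col_norm V => a0 b0 rowE colE rc.
exists k, (fun x => \row_i (a^-1 * U x i)), (fun y => \row_i (a * V i y)).
have dotM (f g : 'I_k -> R) : dot (\row_i f i) (\row_i g i) = \sum_i f i * g i.
  by apply: eq_bigr => i _; rewrite !mxE.
split.
- move=> x y; rewrite dotM AE.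
  (* If [a = 0] then [a^-1 = 0] by convention; [U] vanishes, so both sides are zero. *)
  have [a00|an0] := eqVneq a 0.
    rewrite !big1 // => i _; first by rewrite a00 mul0r mulr0.
    have : U x i ^+ 2 <= 0.
      apply: le_trans (_ : \sum_(i < k) U x i ^+ 2 <= 0).
        rewrite (bigD1 i) //= lerDl; apply: sumr_ge0 => j _; exact: sqr_ge0.
      by have := rowE x; rewrite a00 expr0n.
    by rewrite real_exprn_even_le0 ?num_real //= => /eqP ->; rewrite mul0r.
  by apply: eq_bigr => i _; rewrite mulrACA mulVf // mul1r.
- move=> x; rewrite dotM.
  under eq_bigr => i _ do rewrite -expr2 exprMn.
  rewrite -mulr_sumr; have [a00|an0] := eqVneq a 0.
    by rewrite a00 invr0 expr0n mul0r.
  by rewrite exprVn ler_pdivrMl ?exprn_gt0 ?lt0r ?an0 // mulr1.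
- move=> y; rewrite dotM.
  under eq_bigr => i _ do rewrite -expr2 exprMn.
  rewrite -mulr_sumr; apply: (@le_trans _ _ ((a * b) ^+ 2)).
    by rewrite exprMn ler_wpM2l ?sqr_ge0.
  by rewrite lerXn2r ?nnegrE ?mulr_ge0 //; [apply: ltW (le_lt_trans _ rc); rewrite mulr_ge0 | exact: ltW].
Qed.

(** * Block complexity of the rounded matrix *)

Lemma block_le (X Y : finType) (B : imat X Y) L : block_decomp B L -> block B <= L%:R.
Proof.
move=> dB; apply: ge_inf; last by exists L.
by exists 0 => _ [n [_ ->]].
Qed.

Lemma roundZ_small (X Y : finType) (A : rmat X Y) :
  (forall x y, `|A x y| < 1 / 2) -> forall x y, roundZ A x y = 0.
Proof.
move=> small x y; apply/eqP; rewrite /roundZ /round_near ceil_eq.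
have := small x y; rewrite ltr_norml => /andP[]; rewrite sub0r /=; lra.
Qed.

Theorem theorem5p2 :
  exists C : R, 0 < C /\
  forall (X Y : finType) (gamma : R) (A : rmat X Y),
    (1 < #|Y|)%nat -> 0 < gamma ->
    almost_int (2 `^ (- (20 * gamma ^+ 2))) A ->
    gamma2 A <= gamma ->
    block (roundZ A) <= 2 `^ (C * gamma ^+ 7) * (ln (#|Y|%:R : R)) ^+ 2.
Proof.
exists (20 * 2 ^+ 10); split=> [|X Y gamma A Y1 g0 near g2].
  by rewrite mulr_gt0 ?exprn_gt0 ?ltr0n.
(* Below 1/2 all entries round to zero; from 1/2 on, [G = 2 * gamma ^+ 2] meets the requirement
   [1 / 2 <= G]. *)
have [glt|gge] := ltP gamma (1 / 2).
  have A0 : block_decomp (roundZ A) 0.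
    have := block_decomp0 X Y; apply: block_decomp_ext => x y; apply/esym.
    have [gc c2] := midf_lt glt; set c := (gamma + _) / 2 in gc c2.
    have [k [u [v [AE u1 vG]]]] := gamma2_vectors (le_lt_trans g2 gc).
    apply: roundZ_small => {}x {}y; rewrite AE.
    apply: le_lt_trans c2; rewrite -ler_sqr ?nnegrE //; last exact/ltW/(lt_trans g0).
    by rewrite real_normK ?num_real // (le_trans (dot_sqr_le _ (u1 x))).
  by apply: le_trans (block_le A0) _; rewrite mulr_ge0 ?powR_ge0 ?sqr_ge0.
have [c gc c2] := sqr_slack g0.
have [k [u [v [AE u1 vG]]]] := gamma2_vectors (le_lt_trans g2 gc).
(* With this [G], the admissible error [2^(-10 G)] is exactly the given tolerance. *)
have [||||L dL hL] := @block_decomp_log R k X Y u v (roundZ A) (2 * gamma ^+ 2)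
  (2 `^ (- (20 * gamma ^+ 2))) Y1 _ u1.
- exact: two_sqr_ge_half.
- by move=> y; exact: le_trans c2.
- by move=> x y; rewrite -AE; exact: near.
- by rewrite [10 * _]mulrA -natrM.
apply: le_trans (block_le dL) _; apply: le_trans hL _.
by rewrite ler_wpM2r ?sqr_ge0 // exponent_comparison.
Qed.
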